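(* There exist $\varepsilon>0$, a confidence level $1-\kappa\in(0,1)$, a family of optimization instances $\{\mathbf P_\lambda\}_{\lambda>0}$, $\min_{\mathbf x\in\mathcal X}F(\mathbf x;\lambda)=f(\mathbf x)+\gamma(\lambda)p(\mathbf x)$, with gradient estimators, satisfying the following assumptions defined in the context: LDP of target risk, unbiased and efficient gradient estimators, smoothness and convexity of the average-case loss, sublevel-boundedness, zero minimum of the average-case loss, relative gradient and Hessian bounds, convexity of the combined objective; and a family of unsafe starts $\{\mathbf x_0(\lambda)\}_{\lambda>0}\subset\mathcal X$ (i.e. not satisfying the safe-start condition) satisfying the sub-exponential initial distance assumption, such that for every family of (projected) SGD schemes $\{\mathcal A(\lambda)\}_{\lambda>0}$ with monotonically diminishing step sizes ($\eta_t\ge\eta_{t+1}$ for all $t\ge0$), $$\limsup_{\lambda\to\infty}\frac1\lambda\log T^{\varepsilon,\kappa}_\lambda\big(\mathcal A(\lambda),\mathbf x_0(\lambda)\big)>0 .$$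
   Context: Setting. $\mathcal X\subseteq\mathbb R^n$ is the feasible set, $f:\mathcal X\to\mathbb R$ the average-case loss, $p:\mathcal X\to[0,\infty)$ the extreme risk, $\gamma(\lambda)>0$ a weight for each rarity level $\lambda>0$ ($f,p,\mathcal X$ do not depend on $\lambda$). $F(\mathbf x;\lambda)=f(\mathbf x)+\gamma(\lambda)p(\mathbf x)$; $\mathbf x^*(\lambda)$ is a minimizer of $F(\cdot;\lambda)$ over $\mathcal X$; $p^*(\lambda)=p(\mathbf x^*(\lambda))$. Convention: $\log 0=-\infty$. $\|\cdot\|$ is the Euclidean (or spectral) norm. Assumptions. (i) LDP of target risk: there is $I>0$ with $\lim_{\lambda\to\infty}\frac1\lambda\log p^*(\lambda)=-I$ and $\limsup_{\lambda\to\infty}\frac1\lambda\log\gamma(\lambda)=I$. (ii) Unbiased and efficient gradient estimators: for each $\lambda>0$ there are unbiased estimators $G_f(\mathbf x,\xi)$, $G_p(\mathbf x,\xi;\lambda)$ of $\nabla f(\mathbf x)$, $\nabla p(\mathbf x)$ ($\xi$ random), a constant $\sigma_f\ge0$ and $\sigma_p(\lambda)\ge0$ such that for all $\mathbf x\in\mathcal X$: $\mathbb E\|G_f(\mathbf x,\xi)-\nabla f(\mathbf x)\|^2\le\sigma_f^2$ and $\mathbb E\|G_p(\mathbf x,\xi;\lambda)-\nabla p(\mathbf x)\|^2\le\sigma_p^2(\lambda)\|\nabla p(\mathbf x)\|^2$, with $\limsup_{\lambda\to\infty}\frac1\lambda\log\sigma_p(\lambda)\le0$. (iii) Safe start condition: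 with $I$ from (i), $\limsup_{\lambda\to\infty}\frac1\lambda\log p(\mathbf x_0(\lambda))\le -I$. A family violating it is a family of unsafe starts. (iv) Smoothness and convexity of the average-case loss: $\mathcal X$ is convex, closed, nonempty; $f$ is twice continuously differentiable, convex, and $\|\nabla^2f(\mathbf x)\|\le L_f$ on $\mathcal X$ for some $L_f>0$. (v) Sublevel-boundedness: there are $\epsilon_f,d_f>0$ such that $\{\mathbf x\in\mathcal X: f(\mathbf x)\le\epsilon_f\}$ is nonempty with diameter at most $d_f$. (Hence $f$ has a minimizer $\tilde{\mathbf x}^*$ over $\mathcal X$, which is fixed.) (vi) Zero minimum of the average-case loss: $f(\tilde{\mathbf x}^* )=0$. (vii) Relative gradient and Hessian bounds: $p:\mathcal X\to[0,\infty)$ is twice continuously differentiable and there are $L_{p,1},L_{p,2}>0$, $\beta_1,\beta_2\ge0$ with $\|\nabla p(\mathbf x)\|\le L_{p,1}(1+\|\mathbf x-\tilde{\mathbf x}^*\|^{\beta_1})p(\mathbf x)$ and $\|\nabla^2p(\mathbf x)\|\le L_{p,2}(1+\|\mathbf x-\tilde{\mathbf x}^*\|^{\beta_2})p(\mathbf x)$ for all $\mathbf x\in\mathcal X$. (viii) Convexity of the combined objective: $F(\cdot;\lambda)$ is convex on $\mathcal X$ for every $\lambda>0$. (ix) Sub-exponential initial distance: $\limsup_{\lambda\to\infty}\frac1\lambda\log\|\mathbf x_0(\lambda)-\tilde{\mathbf x}^*\|\le0$. SGD. Given deterministic step sizes $\eta_t>0$ and a mini-batch size $B\ge1$, $\mathbf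 x_{t+1}=\Pi_{\mathcal X}(\mathbf x_t-\eta_t\bar G_t)$, $\bar G_t=\frac1B\sum_{i=1}^B\big(G_f(\mathbf x_t,\xi_{t,i})+\gamma(\lambda)G_p(\mathbf x_t,\xi_{t,i};\lambda)\big)$, with $\xi_{t,i}$ i.i.d. and $\Pi_{\mathcal X}$ the Euclidean projection. A scheme $\mathcal A$ specifies the step sizes, the constant mini-batch size $B$, and the output after $T$ iterations, which is either the last iterate $\mathbf x_T$ or the weighted average $\bar{\mathbf x}_T=\sum_{t=0}^{T-1}\eta_t\mathbf x_{t+1}/\sum_{t=0}^{T-1}\eta_t$. For $T=0$ the output is $\mathbf x_0$. Sampling complexity. $T^{\varepsilon,\kappa}_\lambda(\mathcal A,\mathbf x_0)$ is the minimum number $T\cdot B$ of stochastic gradient samples such that the output $\hat{\mathbf x}$ after $T$ iterations started at $\mathbf x_0$ satisfies $F(\hat{\mathbf x};\lambda)\le(1+\varepsilon)F(\mathbf x^*(\lambda);\lambda)$ with probability at least $1-\kappa$ ($+\infty$ if there is none). *)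

(* Defs.v *)
(* Library: MathComp-Analysis, over an abstract R : realType. *)
From HB Require Import structures.
From mathcomp Require Import all_boot all_order all_algebra.
From mathcomp Require Import all_classical all_reals all_analysis.
Set Implicit Arguments.
Unset Strict Implicit.
Unset Printing Implicit Defensive.
Import Order.TTheory GRing.Theory Num.Theory.
Import numFieldNormedType.Exports.
Local Open Scope classical_set_scope.
Local Open Scope ring_scope.

Section euclidean.
Context {R : realType} {n : nat}.
Local Notation V := 'rV[R]_n.
Implicit Types (X : set V) (f : V -> R) (x y : V).

(* The norm the library puts on row vectors is the sup norm.  It induces the
   same topology and the same differentials as the Euclidean norm, so [open],
   [closed], [continuous] and [differentiable] can be used unchanged. *)
Definition enorm x : R := Num.sqrt (\sum_j x 0 j ^+ 2).

Definition spectral_norm (A : 'M[R]_n) : R :=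
  sup [set enorm (v *m A) | v in [set v : V | enorm v <= 1]].

Definition diameter X : \bar R :=
  ereal_sup [set (enorm (x - y))%:E | x in X & y in X].

(* The nearest point is unique when X is closed, convex and nonempty; the
   default value y is only used when there is none. *)
Definition euclid_proj X y : V :=
  xget y [set z | X z /\ forall u, X u -> enorm (y - z) <= enorm (y - u)].

Definition minimizer X f x := X x /\ forall y, X y -> f x <= f y.

Definition partial (i : 'I_n) f x : R := 'D_(delta_mx 0 i) f x.

Definition grad f x : V := \row_i partial i f x.

Definition hess f x : 'M[R]_n := \matrix_(i, j) partial j (partial i f) x.

(* f is the restriction to X of a C^2 function on an open neighbourhood U of X,
   so that its derivatives are defined at the boundary points of X as well. *)
Definition C2_on X f := exists U : set V,
  [/\ open U, X `<=` U &
      forall x, U x ->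
        [/\ differentiable f x,
            forall i, differentiable (partial i f) x &
            forall i j, {for x, continuous (partial j (partial i f))}]].

End euclidean.

Section growth.
Context {R : realType}.
Local Open Scope ereal_scope.

(* [lne] is the extended logarithm: lne 0 = -oo and lne +oo = +oo. *)
Definition log_rate (u : R -> \bar R) (l : R) : \bar R :=
  (l^-1)%:E * lne (u l).

Definition limsup_rate (u : R -> \bar R) : \bar R :=
  limf_esup (log_rate u) +oo%R.

End growth.

Record problem (R : realType) (n : nat) := Problem {
  feasible : set 'rV[R]_n;
  loss : 'rV[R]_n -> R;
  risk : 'rV[R]_n -> R;
  weight : R -> R
}.

Definition objective (R : realType) (n : nat) (Q : problem R n) (l : R)
    (x : 'rV[R]_n) : R :=
  loss Q x + weight Q l * risk Q x.

Section assumptions.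
Context {R : realType} {n : nat}.
Local Notation V := 'rV[R]_n.
Variable Q : problem R n.
Local Notation X := (feasible Q).
Local Notation f := (loss Q).
Local Notation p := (risk Q).
Local Notation gamma := (weight Q).
Implicit Types (xmin : V) (xstar : R -> V).

Definition target_risk_LDP xstar (I : R) :=
  [/\ 0 < I,
      log_rate (fun l => (p (xstar l))%:E) l @[l --> +oo] --> (- I)%:E &
      limsup_rate (fun l => (gamma l)%:E) = I%:E].

Definition safe_start (x0 : R -> V) (I : R) :=
  (limsup_rate (fun l => (p (x0 l))%:E) <= (- I)%:E)%E.

Definition smooth_convex_loss :=
  [/\ convex_set X, closed X, X !=set0, C2_on X f &
      convex_function X f /\
      exists2 Lf : R, 0 < Lf &
        forall x, X x -> spectral_norm (hess f x) <= Lf].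

Definition sublevel_bounded :=
  exists ef df : R,
    [/\ 0 < ef, 0 < df,
        (X `&` [set x | (f x <= ef)%R]) !=set0 &
        (diameter (X `&` [set x | (f x <= ef)%R]) <= df%:E)%E].

Definition relative_bounds xmin :=
  [/\ forall x, X x -> 0 <= p x, C2_on X p &
      exists L1 L2 b1 b2 : R,
        [/\ 0 < L1, 0 < L2, 0 <= b1, 0 <= b2 &
            forall x, X x ->
              enorm (grad p x) <= L1 * (1 + enorm (x - xmin) `^ b1) * p x /\
              spectral_norm (hess p x)
                <= L2 * (1 + enorm (x - xmin) `^ b2) * p x]].

Definition convex_objective :=
  forall l : R, 0 < l -> convex_function X (objective Q l).

Definition subexponential_distance xmin (x0 : R -> V) :=
  (limsup_rate (fun l => (enorm (x0 l - xmin))%:E) <= 0)%E.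

End assumptions.

(* The law of the sample xi together with the estimators G_f(x, xi) and
   G_p(x, xi; l) of the gradients of the loss and of the risk. *)
Record oracle (R : realType) (n : nat) (d : measure_display)
    (Xi : measurableType d) := Oracle {
  noise_law : probability Xi R;
  loss_grad : 'rV[R]_n -> Xi -> 'rV[R]_n;
  risk_grad : R -> 'rV[R]_n -> Xi -> 'rV[R]_n
}.

Section estimators.
Context {R : realType} {n : nat} {d : measure_display} {Xi : measurableType d}.
Local Notation V := 'rV[R]_n.
Local Notation borelV := (g_sigma_algebraType (@open V)).

(* Joint Borel measurability on X x Xi makes the SGD iterates random vectors. *)
Definition unbiased_estimator (X : set V) (mu : probability Xi R)
    (G : V -> Xi -> V) (g : V -> V) :=
  (forall j, measurable_fun ((X : set borelV) `*` [set: Xi])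
               (fun xz : borelV * Xi => G xz.1 xz.2 ord0 j)) /\
  forall x, X x -> forall j,
    mu.-integrable [set: Xi] (fun z => (G x z ord0 j)%:E) /\
    ('E_mu[fun z => G x z ord0 j] = (g x ord0 j)%:E)%E.

Definition efficient_estimators (Q : problem R n) (O : oracle R n Xi) :=
  exists (sf : R) (sp : R -> R),
    [/\ 0 <= sf, forall l, 0 < l -> 0 <= sp l,
        (limsup_rate (fun l => (sp l)%:E) <= 0)%E,
        unbiased_estimator (feasible Q) (noise_law O) (loss_grad O)
          (grad (loss Q)) /\
        (forall x, feasible Q x ->
          ('E_(noise_law O)[fun z => (enorm (loss_grad O x z - grad (loss Q) x) ^+ 2)%R]
             <= (sf ^+ 2)%:E)%E) &
        forall l, 0 < l ->
          unbiased_estimator (feasible Q) (noise_law O) (risk_grad O l)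
            (grad (risk Q)) /\
          (forall x, feasible Q x ->
            ('E_(noise_law O)[fun z =>
                 (enorm (risk_grad O l x z - grad (risk Q) x) ^+ 2)%R]
               <= (sp l ^+ 2 * enorm (grad (risk Q) x) ^+ 2)%:E)%E)].

Context {dO : measure_display} {Omega : measurableType dO}.

(* The array (xi_{t,i}) is i.i.d. with law mu: its members have law mu, and the
   product rule holds for every finite subfamily.  A scheme with mini-batch size
   B reads the entries with i < B. *)
Definition iid_array (P : probability Omega R) (mu : probability Xi R)
    (xi : nat -> nat -> {RV P >-> Xi}) :=
  (forall t i (A : set Xi), measurable A -> distribution P (xi t i) A = mu A) /\
  forall (J : seq (nat * nat)) (A : nat * nat -> set Xi),
    uniq J -> (forall j, measurable (A j)) ->
    P (\bigcap_(j in [set` J]) (xi j.1 j.2 @^-1` A j)) =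
    (\prod_(j <- J) P (xi j.1 j.2 @^-1` A j))%E.

End estimators.

Inductive output_rule := LastIterate | WeightedAverage.

Record sgd_scheme (R : realType) := SgdScheme {
  step : nat -> R;
  step_gt0 : forall t, 0 < step t;
  batch : nat;
  batch_gt0 : (0 < batch)%N;
  output : output_rule
}.

Definition diminishing (R : realType) (A : sgd_scheme R) :=
  forall t, step A t.+1 <= step A t.

Section sgd.
Context {R : realType} {n : nat} {d : measure_display} {Xi : measurableType d}
  {dO : measure_display} {Omega : measurableType dO}.
Local Notation V := 'rV[R]_n.
Variables (Q : problem R n) (O : oracle R n Xi) (P : probability Omega R)
  (xi : nat -> nat -> {RV P >-> Xi}).

Definition batch_grad (l : R) (B t : nat) (x : V) (w : Omega) : V :=
  (B%:R)^-1 *: \sum_(i < B)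
    (loss_grad O x (xi t i w) + weight Q l *: risk_grad O l x (xi t i w)).

Fixpoint iterate (A : sgd_scheme R) (l : R) (x0 : V) (t : nat) (w : Omega)
    : V :=
  if t is s.+1 then
    let x := iterate A l x0 s w in
    euclid_proj (feasible Q) (x - step A s *: batch_grad l (batch A) s x w)
  else x0.

Definition weighted_average (A : sgd_scheme R) (l : R) (x0 : V) (T : nat)
    (w : Omega) : V :=
  (\sum_(t < T) step A t)^-1 *:
    \sum_(t < T) step A t *: iterate A l x0 t.+1 w.

Definition sgd_output (A : sgd_scheme R) (l : R) (x0 : V) (T : nat) (w : Omega)
    : V :=
  if T is 0 then x0 else
  match output A with
  | LastIterate => iterate A l x0 T w
  | WeightedAverage => weighted_average A l x0 T w
  end.

(* xs is a minimizer of [objective Q l]; the infimum over an empty set of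
   horizons is +oo. *)
Definition sampling_complexity (eps kappa : R) (A : sgd_scheme R) (l : R)
    (xs x0 : V) : \bar R :=
  ereal_inf [set ((T * batch A)%N%:R)%:E | T in [set T : nat |
    ((1 - kappa)%:E <= P [set w |
      (objective Q l (sgd_output A l x0 T w)
         <= (1 + eps) * objective Q l xs)%R])%E]].

End sgd.

(* Main.v *)
(* In the plane take f(x, y) = h(x) + h(y) with h(s) = sqrt(1 + s^2) - 1 and
   p(x, y) = exp(-x), with exact gradients, so that SGD is gradient descent and
   probability plays no role.  For the weight g = h'(l) exp(l) the objective is
   minimal at (l, 0), with value at most l + 1 although p equals exp(-l) there.
   Start at the unsafe point (0, 2 l + 4).  The first step moves x by g times
   the first step size e, and as |h'| <= 1 and the steps diminish, each later
   step decreases x by at most e, while y decreases by at most e per step.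
   Hence after T steps x >= e (g - T) and y >= 2 l + 4 - T e.  Twice the optimal
   value forces x, y <= 2 l + 3, so T e >= 1 and e (g - T) <= (2 l + 3) T e, that
   is T >= g / (2 l + 4).  A large first step thus overshoots in x and a small
   one leaves y out of reach: both cost exponentially many steps. *)
Require Import Defs.
From HB Require Import structures.
From mathcomp Require Import all_boot all_order all_algebra.
From mathcomp Require Import all_classical all_reals all_analysis.
From mathcomp Require Import ring lra.
Import Order.TTheory GRing.Theory Num.Theory.
Import numFieldNormedType.Exports.
Local Open Scope classical_set_scope.
Local Open Scope convex_scope.
Local Open Scope ring_scope.

(** * Derivatives and convexity of sums of one-variable functions of the coordinates *)

Section separable_functions.
Context {R : realType} {n : nat}.
Local Notation V := 'rV[R]_n.
Implicit Types (u du ddu : 'I_n -> R -> R) (x v : V).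

Definition separable u x : R := \sum_j u j (x 0 j).

Lemma differentiable_compose_coord (g : R -> R) (j : 'I_n) x :
  derivable g (x 0 j) 1 -> differentiable (fun y : V => g (y 0 j)) x.
Proof.
move=> dg; apply: (@differentiable_comp _ _ _ _ (fun y : V => y 0 j) g).
  exact: differentiable_coord.
exact/derivable1_diffP.
Qed.

Lemma derive_compose_coord (g : R -> R) (j i : 'I_n) x :
  derivable g (x 0 j) 1 ->
  'D_(delta_mx 0 i) (fun y : V => g (y 0 j)) x = (i == j)%:R * 'D_1 g (x 0 j).
Proof.
move=> dg; rewrite deriveE; last exact: differentiable_compose_coord.
have dc : differentiable (fun y : V => y 0 j : R) x.
  exact: differentiable_coord.
have dg' : differentiable g (x 0 j) by exact/derivable1_diffP.
have -> : (fun y : V => g (y 0 j)) = g \o (fun y : V => y 0 j) by [].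
rewrite diff_comp//= diff1E//= derive1E; congr (_ *: _).
rewrite -deriveE//.
(* The difference quotient of a coordinate is constant away from [h = 0], so its limit needs no
   estimate. *)
have h0 : (fun h : R => h^-1 *: ((h *: (delta_mx 0 i : V) + x) 0 j - x 0 j))
  @ 0^' --> ((i == j)%:R : R).
  apply: cvg_near_cst; near=> h.
  rewrite !mxE /= addrK eq_sym -[LHS]/(_ * _) mulKf//.
  by near: h; exact: nbhs_dnbhs_neq.
exact/cvg_lim.
Unshelve. all: by end_near. Qed.

Lemma differentiable_separable u x :
  (forall j (s : R), derivable (u j) s 1) -> differentiable (separable u) x.
Proof.
move=> du.
have -> : separable u = \sum_(j < n) (fun y : V => u j (y 0 j)).
  by apply/funext => y; rewrite fct_sumE.
by apply: differentiable_sum => j; exact: differentiable_compose_coord.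
Qed.

Lemma partial_separable u du i :
  (forall j (s : R), is_derive s 1 (u j) (du j s)) ->
  partial i (separable u) = fun x => du i (x 0 i).
Proof.
move=> udu; apply/funext => x; rewrite /partial.
have -> : separable u = \sum_(j < n) (fun y : V => u j (y 0 j)).
  by apply/funext => y; rewrite fct_sumE.
rewrite derive_sum; last first.
  move=> j; apply/diff_derivable/differentiable_compose_coord.
  by case: (udu j (x 0 j)).
rewrite (bigD1 i)//= big1 ?addr0 => [|j ji].
  by rewrite derive_compose_coord ?eqxx ?mul1r ?derive_val.
by rewrite derive_compose_coord 1?eq_sym ?(negbTE ji) ?mul0r.
Qed.

Lemma grad_separable u du x :
  (forall j (s : R), is_derive s 1 (u j) (du j s)) ->
  grad (separable u) x = \row_j du j (x 0 j).
Proof.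
by move=> udu; apply/rowP => j; rewrite !mxE (partial_separable _ _ _ udu).
Qed.

Lemma partial_compose_coord (g dg : R -> R) (i j : 'I_n) :
  (forall s : R, is_derive s 1 g (dg s)) ->
  partial j (fun x : V => g (x 0 i)) = fun x => (j == i)%:R * dg (x 0 i).
Proof.
move=> gdg; apply/funext => x; rewrite /partial derive_compose_coord.
  by rewrite derive_val.
by case: (gdg (x 0 i)).
Qed.

Lemma hess_separable u du ddu x :
  (forall j (s : R), is_derive s 1 (u j) (du j s)) ->
  (forall j (s : R), is_derive s 1 (du j) (ddu j s)) ->
  hess (separable u) x = diag_mx (\row_j ddu j (x 0 j)).
Proof.
move=> udu duddu; apply/matrixP => i j; rewrite !mxE.
rewrite (partial_separable _ _ _ udu) (partial_compose_coord _ _ _ _ (duddu i)).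
by rewrite eq_sym; case: eqP => [->|]; rewrite ?mul1r ?mulr1n ?mul0r.
Qed.

Lemma C2_on_separable u du ddu (X : set V) :
  (forall j (s : R), is_derive s 1 (u j) (du j s)) ->
  (forall j (s : R), is_derive s 1 (du j) (ddu j s)) ->
  (forall j, continuous (ddu j)) ->
  C2_on X (separable u).
Proof.
move=> udu duddu cddu; exists setT; split => //; first exact: openT.
move=> x _; split.
- by apply: differentiable_separable => j s; case: (udu j s).
- move=> i; rewrite (partial_separable _ _ _ udu).
  by apply: differentiable_compose_coord; case: (duddu i (x 0 i)).
- move=> i j; rewrite (partial_separable _ _ _ udu).
  rewrite (partial_compose_coord _ _ _ _ (duddu i)).
  apply: (@continuousM R V (cst (j == i)%:R) (fun y => ddu i (y 0 i)) x).
    exact: cst_continuous.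
  apply: (@continuous_comp _ _ _ (fun y : V => y 0 i) (ddu i)).
    exact: coord_continuous.
  exact: cddu.
Qed.

(** In each coordinate, take the tangent at the intermediate point [z] and average its bounds at the
    two ends with weights [t] and [1 - t]: the linear terms cancel. *)
Lemma convex_separable u du (X : set V) :
  (forall j s t, u j s + du j s * (t - s) <= u j t) ->
  convex_function X (separable u).
Proof.
move=> tangent t x y _ _.
have cR (a b : R^o) : a <| t |> b = t%:num * a + (1 - t%:num) * b by [].
rewrite !cR /separable !mulr_sumr -big_split/=.
apply: ler_sum => j _.
have -> : ((x : convex_lmodType V) <| t |> y) 0 j =
    t%:num * x 0 j + (1 - t%:num) * y 0 j.
  by rewrite /= /conv /= !mxE.
set z := t%:num * x 0 j + _.
have t0 : 0 <= t%:num by [].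
have t1 : 0 <= 1 - t%:num by rewrite subr_ge0.
have := lerD (ler_wpM2l t0 (tangent j z (x 0 j)))
             (ler_wpM2l t1 (tangent j z (y 0 j))).
apply: le_trans; rewrite le_eqVlt; apply/orP; left; apply/eqP.
by rewrite /z; ring.
Qed.

End separable_functions.

(** * Euclidean norm, projection onto the whole space, spectral norm of diagonal matrices *)

Section euclidean_norm.
Context {R : realType} {n : nat}.
Local Notation V := 'rV[R]_n.
Implicit Types (x y : V).

Lemma enorm0_eq0 x : enorm x = 0 -> x = 0.
Proof.
move=> /eqP; rewrite /enorm sqrtr_eq0 => s0.
have /psumr_eq0P h : \sum_j x 0 j ^+ 2 = 0.
  by apply/eqP; rewrite eq_le s0 sumr_ge0// => j _; exact: sqr_ge0.
apply/rowP => j; rewrite mxE; apply/eqP; rewrite -sqrf_eq0; apply/eqP.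
by apply: h => // i _; exact: sqr_ge0.
Qed.

Lemma enorm0 : enorm (0 : V) = 0.
Proof. by rewrite /enorm big1 ?sqrtr0// => j _; rewrite mxE expr0n. Qed.

Lemma euclid_proj_setT y : euclid_proj [set: V] y = y.
Proof.
rewrite /euclid_proj; apply: xget_unique => [|z [_ /(_ y Logic.I)]].
  split => // u _; rewrite subrr enorm0; exact: sqrtr_ge0.
rewrite subrr enorm0 => yz; apply/esym/eqP; rewrite -subr_eq0; apply/eqP.
by apply: enorm0_eq0; apply/eqP; rewrite eq_le yz sqrtr_ge0.
Qed.

(** Each coordinate is multiplied by a factor of modulus at most [c], so the Euclidean norm grows by
    at most that factor. *)
Lemma spectral_norm_diag (a : V) (c : R) :
  0 <= c -> (forall j, `|a 0 j| <= c) -> spectral_norm (diag_mx a) <= c.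
Proof.
move=> c0 ac; apply: ge_sup.
  by exists (enorm (0 *m diag_mx a)), 0 => //=; rewrite enorm0.
move=> _ [v /= v1 <-]; rewrite /enorm mul_mx_diag.
apply: (@le_trans _ _ (Num.sqrt (c ^+ 2 * \sum_j v 0 j ^+ 2))).
  apply: ler_wsqrtr; rewrite mulr_sumr; apply: ler_sum => j _.
  rewrite mxE exprMn mulrC; apply: ler_wpM2r; first exact: sqr_ge0.
  by rewrite -real_normK ?num_real// lerXn2r// nnegrE.
by rewrite sqrtrM ?sqr_ge0// sqrtr_sqr ger0_norm// ler_piMr.
Qed.

End euclidean_norm.

(** * Exponential growth rates *)

Section rates.
Context {R : realType}.
Implicit Types (u v : R -> \bar R) (a c l M : R).

(** The supremum over the ray beyond [M] bounds the limsup. The slack [e] allows constant and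
    polynomial factors to be absorbed into an exponential. *)
Lemma limsup_rate_le u c :
  (forall e : R, 0 < e -> exists M, forall l, M < l ->
    (log_rate u l <= (c + e)%:E)%E) ->
  (limsup_rate u <= c%:E)%E.
Proof.
move=> h; apply/lee_addgt0Pr => e e0; have [M hM] := h e e0.
apply: (@le_trans _ _ (ereal_sup (log_rate u @` [set l | M < l]))).
  apply: ereal_inf_lbound; exists [set l | M < l] => //.
  by exists M; split => //; exact: num_real.
by apply: ge_ereal_sup => _ [l /= Ml <-]; rewrite -EFinD; exact: hM.
Qed.

(** Every neighbourhood of [+oo] contains a point beyond [M], so every supremum that enters the
    limsup is at least [c]. *)
Lemma limsup_rate_ge u c M :
  (forall l, M < l -> (c%:E <= log_rate u l)%E) -> (c%:E <= limsup_rate u)%E.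
Proof.
move=> h; apply: le_ereal_inf_tmp => _ [A [N [_ hN]] <-].
have lt1 : N < Num.max M N + 1.
  by rewrite (@le_lt_trans _ _ (Num.max M N))// ?ltrDl// le_max lexx orbT.
have lt2 : M < Num.max M N + 1.
  by rewrite (@le_lt_trans _ _ (Num.max M N))// ?ltrDl// le_max lexx.
apply: (le_trans (h _ lt2)); apply: ereal_sup_ubound.
by exists (Num.max M N + 1) => //; exact: hN.
Qed.

Lemma log_rate_fin (u : R -> R) l : 0 < u l ->
  log_rate (fun l => (u l)%:E) l = (l^-1 * ln (u l))%:E.
Proof. by move=> ul; rewrite /log_rate lne_EFin. Qed.

(** Exponentials are the yardsticks: together with the monotonicity of [log_rate], this reduces rate
    estimates to real inequalities. *)
Lemma log_rate_expR a l : l != 0 ->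
  log_rate (fun l => (expR (a * l))%:E) l = a%:E.
Proof.
by move=> l0; rewrite log_rate_fin ?expR_gt0// expRK mulrCA mulVf ?mulr1.
Qed.

Lemma le_log_rate u v l : 0 < l -> (0 <= u l)%E -> (u l <= v l)%E ->
  (log_rate u l <= log_rate v l)%E.
Proof.
move=> l0 u0 uv; rewrite /log_rate lee_pmul2l ?lte_fin ?invr_gt0//.
by rewrite lee_lne// in_itv/= leey ?u0// (le_trans u0).
Qed.

End rates.

(** * Borel measurability of continuous functions *)

Section continuous_measurability.
Context {R : realType} {n : nat}.

(** Open rays generate the Borel sets of the line, and their preimages under [g] are open. *)
Lemma continuous_borel_measurable (g : 'rV[R]_n -> R) :
  continuous g ->
  measurable_fun setT (g : g_sigma_algebraType (@open 'rV[R]_n) -> R).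
Proof.
move=> cg; apply: (measurability _ (@measurable_realfun.RGenOInfty.measurableE R)).
move=> _ [_ [x ->] <-]; rewrite setTI; apply: sub_sigma_algebra.
by apply: open_comp => //; exact: interval_open.
Qed.

End continuous_measurability.

(** * The pseudo-Huber function and the decaying exponential on the line *)

Section pseudo_huber.
Context {R : realType}.
Implicit Types (s t l : R).

(** The Japanese bracket. Subtracting 1 gives the pseudo-Huber function, quadratic near 0 and of
    linear growth; its bounded slope is what keeps the steps of gradient descent short. *)
Definition bracket s : R := Num.sqrt (1 + s ^+ 2).
Definition huber s : R := bracket s - 1.
Definition dhuber s : R := s / bracket s.
Definition ddhuber s : R := (bracket s)^-1 ^+ 3.

Lemma bracket_gt0 s : 0 < bracket s.
Proof. by rewrite sqrtr_gt0 ltr_pwDl// sqr_ge0. Qed.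

Lemma sqr_bracket s : bracket s ^+ 2 = 1 + s ^+ 2.
Proof. by rewrite sqr_sqrtr// addr_ge0// sqr_ge0. Qed.

Lemma bracket_ge1 s : 1 <= bracket s.
Proof.
rewrite -(ler_pXn2r (n := 2)) ?nnegrE ?(ltW (bracket_gt0 s))//.
by rewrite sqr_bracket expr1n lerDl sqr_ge0.
Qed.

Lemma norm_le_bracket s : `|s| <= bracket s.
Proof. by rewrite -sqrtr_sqr ler_wsqrtr// lerDr. Qed.

Lemma bracket_le s : bracket s <= 1 + `|s|.
Proof.
rewrite -(ler_pXn2r (n := 2)) ?nnegrE ?(ltW (bracket_gt0 s))// ?addr_ge0//.
rewrite sqr_bracket.
rewrite -(real_normK (num_real s)); have := normr_ge0 s; nra.
Qed.

Lemma huber0 : huber 0 = 0.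
Proof. by rewrite /huber /bracket expr0n addr0 sqrtr1 subrr. Qed.

Lemma huber_ge0 s : 0 <= huber s.
Proof. by rewrite subr_ge0 bracket_ge1. Qed.

Lemma huber_ge s : `|s| - 1 <= huber s.
Proof. by rewrite lerD2r norm_le_bracket. Qed.

Lemma huber_le s : huber s <= `|s|.
Proof. by rewrite lerBlDl bracket_le. Qed.

Lemma dhuber0 : dhuber 0 = 0.
Proof. by rewrite /dhuber mul0r. Qed.

Lemma norm_dhuber_le1 s : `|dhuber s| <= 1.
Proof.
rewrite /dhuber normrM normfV (gtr0_norm (bracket_gt0 s)).
by rewrite ler_pdivrMr ?bracket_gt0// mul1r norm_le_bracket.
Qed.

Lemma dhuber_gt0 s : 0 < s -> 0 < dhuber s.
Proof. by move=> s0; rewrite divr_gt0// bracket_gt0. Qed.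

Lemma dhuber_ge_half s : 1 <= s -> 2^-1 <= dhuber s.
Proof.
move=> s1; rewrite ler_pdivlMr ?bracket_gt0//.
by have := bracket_le s; rewrite ger0_norm; lra.
Qed.

Lemma huber_tangent s t : huber s + dhuber s * (t - s) <= huber t.
Proof.
have w0 := bracket_gt0 s.
(* Multiplying by [bracket s] turns the tangent inequality into Cauchy-Schwarz for the vectors
   [(1, s)] and [(1, t)]. *)
suff : 1 + s * t <= bracket s * bracket t.
  have -> : huber s + dhuber s * (t - s) = (1 + s * t) / bracket s - 1.
    rewrite /huber /dhuber; apply: (mulfI (lt0r_neq0 w0)).
    rewrite !(mulrDr (bracket s)) mulrA (mulrCA (bracket s) s).
    rewrite divff ?lt0r_neq0// mulr1.
    rewrite (mulrCA (bracket s) (1 + _)) divff ?lt0r_neq0// mulr1 -expr2.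
    by rewrite sqr_bracket; ring.
  by move=> h; rewrite /huber lerD2r ler_pdivrMr// [leRHS]mulrC.
(* Both sides must be nonnegative before they are squared; the difference of the squares is then
   [(s - t) ^+ 2]. *)
have [neg|pos] := ltP (1 + s * t) 0.
  by rewrite (le_trans (ltW neg))// mulr_ge0 ?(ltW (bracket_gt0 _)).
rewrite -(ler_pXn2r (n := 2)) ?nnegrE ?mulr_ge0 ?(ltW (bracket_gt0 _))//.
rewrite exprMn !sqr_bracket -subr_ge0.
have -> : (1 + s ^+ 2) * (1 + t ^+ 2) - (1 + s * t) ^+ 2 = (s - t) ^+ 2 by ring.
exact: sqr_ge0.
Qed.

Lemma ddhuber_ge0 s : 0 <= ddhuber s.
Proof. by rewrite exprn_ge0// invr_ge0 ltW// bracket_gt0. Qed.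

Lemma ddhuber_le1 s : ddhuber s <= 1.
Proof.
rewrite exprn_ile1// ?invr_ge0 ?invf_le1 ?bracket_gt0 ?bracket_ge1//.
by rewrite ltW// bracket_gt0.
Qed.

Lemma is_derive_bracket s : is_derive s 1 bracket (dhuber s).
Proof.
have p0 : 0 < 1 + s ^+ 2 by rewrite ltr_pwDl// sqr_ge0.
have := is_derive1_sqrt p0 => d1.
have d2 : is_derive s 1 (fun s : R => 1 + s ^+ 2) (2 * s).
  by apply: is_derive_eq; rewrite /GRing.scale/=; ring.
have h := @is_derive1_comp R Num.sqrt (fun s => 1 + s ^+ 2) s _ _ d1 d2.
apply: (is_derive_eq h).
by rewrite /dhuber /bracket; field; rewrite gt_eqF// sqrtr_gt0.
Qed.

Lemma is_derive_huber s : is_derive s 1 huber (dhuber s).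
Proof.
have := is_derive_bracket s => d; rewrite /huber; apply: is_derive_eq.
by rewrite subr0.
Qed.

Lemma is_derive_dhuber s : is_derive s 1 dhuber (ddhuber s).
Proof.
have w0 := bracket_gt0 s; have d := is_derive_bracket s.
have dV := @is_deriveV R bracket s (dhuber s) 1 (lt0r_neq0 w0) d.
rewrite /dhuber; apply: is_derive_eq; rewrite /GRing.scale/= /ddhuber.
transitivity ((bracket s ^+ 2 - s ^+ 2) * (bracket s)^-1 ^+ 3).
  by rewrite /dhuber; field; rewrite gt_eqF.
by rewrite sqr_bracket addrK mul1r.
Qed.

Lemma continuous_ddhuber : continuous (ddhuber : R -> R).
Proof.
move=> s; apply: (@continuous_comp _ _ _ (fun x => (bracket x)^-1)
  (fun x => x ^+ 3)); last exact: exprn_continuous.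
apply: cvgV; first by rewrite gt_eqF ?bracket_gt0.
apply: differentiable_continuous; apply/derivable1_diffP.
by case: (is_derive_bracket s).
Qed.

(** The factor [a] covers both coordinates of the risk at once, with [a = 1] and [a = 0]. *)
Lemma is_derive_expRN (a s : R) :
  is_derive s 1 (fun s => a * expR (- s)) (- a * expR (- s)).
Proof.
by apply: is_derive_eq; rewrite /GRing.scale/=; ring.
Qed.

Lemma expRN_tangent s t : expR (- s) - expR (- s) * (t - s) <= expR (- t).
Proof.
have -> : - t = - s + (s - t) by ring.
rewrite expRD -[X in X - _]mulr1 -mulrBr ler_wpM2l ?expR_ge0//.
by apply: le_trans (expR_ge1Dx _); lra.
Qed.

Lemma continuous_expRN (a : R) : continuous (fun s => a * expR (- s)).
Proof.
move=> s; apply: differentiable_continuous; apply/derivable1_diffP.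
by case: (is_derive_expRN a s).
Qed.

End pseudo_huber.

(** * SGD with exact gradients is gradient descent *)

Section exact_gradients.
Context {R : realType} {n : nat} {d : measure_display} {Xi : measurableType d}.
Local Notation V := 'rV[R]_n.

Lemma exact_estimator (X : set V) (mu : probability Xi R) (g : V -> V) :
  X = setT -> (forall j, continuous (fun x => g x 0 j : R)) ->
  unbiased_estimator X mu (fun x _ => g x) g.
Proof.
move=> -> cg; split=> [j|x _ j].
  rewrite setXTT.
  exact: (measurableT_comp (continuous_borel_measurable _ (cg j))
    measurable_fst).
split; first exact: finite_measure_integrable_cst.
exact: expectation_cst.
Qed.

Lemma exact_estimator_error (mu : probability Xi R) (g : V) :
  ('E_mu[fun z : Xi => (enorm (g - g) ^+ 2)%R] = 0)%E.
Proof. by rewrite subrr enorm0 expr0n; exact: expectation_cst. Qed.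

Context {dO : measure_display} {Omega : measurableType dO}.

(** A mini-batch averages equal vectors, and the projection onto the whole space is the identity. *)
Lemma iterate_exact (Q : problem R n) (O : oracle R n Xi)
    (P : probability Omega R) (xi : nat -> nat -> {RV P >-> Xi})
    (A : sgd_scheme R) (l : R) (x0 : V) t w :
  feasible Q = setT ->
  (forall x z, loss_grad O x z = grad (loss Q) x) ->
  (forall x z, risk_grad O l x z = grad (risk Q) x) ->
  let x := iterate Q O xi A l x0 t w in
  iterate Q O xi A l x0 t.+1 w =
    x - step A t *: (grad (loss Q) x + weight Q l *: grad (risk Q) x).
Proof.
move=> QT Of Op x; rewrite /= QT euclid_proj_setT -/x; congr (_ - _ *: _).
rewrite /batch_grad; under eq_bigr do rewrite Of Op.
rewrite sumr_const card_ord -[X in _ *: X]scaler_nat scalerA mulVf ?scale1r//.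
by rewrite pnatr_eq0 -lt0n batch_gt0.
Qed.

End exact_gradients.

(** On a one-point space every preimage of [A] is [A] itself, and the Dirac mass of an intersection
    is the product of the Dirac masses. *)
Lemma iid_array_unit (R : realType)
    (mu := \d_tt : probability unit R)
    (xi : nat -> nat -> {RV mu >-> unit}) :
  iid_array mu xi.
Proof.
have xitt t i : xi t i tt = tt by case: (xi t i tt).
have imm t i (A : set unit) : xi t i @^-1` A = A.
  by apply/seteqP; split => -[] /=; rewrite xitt.
split => [t i A mA|J A _ mA].
  by rewrite /distribution /pushforward imm.
elim: J => [|j J IH].
  by rewrite big_nil set_nil bigcap_set0 probability_setT.
rewrite big_cons bigcap_seq big_cons -bigcap_seq -IH imm.
rewrite /mu/= !diracE in_setI -EFinM.
by case: (_ \in A j); case: (_ \in _); rewrite ?mul1r ?mul0r.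
Qed.

(** * Bounds on the output and on the steps of a scheme *)

Section scheme_output.
Context {R : realType} {n : nat} {d : measure_display} {Xi : measurableType d}.
Context {dO : measure_display} {Omega : measurableType dO}.

(** Both output rules return a convex combination of the iterates with indices 1 to [T], so a common
    lower bound on a coordinate passes to the output. At [T = 0] the output is the start instead. *)
Lemma sgd_output_coord_ge (Q : problem R n) (O : oracle R n Xi)
    (P : probability Omega R) (xi : nat -> nat -> {RV P >-> Xi})
    (A : sgd_scheme R) (l : R) (x0 : 'rV[R]_n) T w j c :
  (0 < T)%N ->
  (forall t, (t < T)%N -> c <= iterate Q O xi A l x0 t.+1 w 0 j) ->
  c <= sgd_output Q O xi A l x0 T w 0 j.
Proof.
case: T => // T _ h; rewrite /sgd_output; case: (output A); first exact: h.
rewrite /weighted_average mxE summxE.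
have s0 : 0 < \sum_(t < T.+1) step A t.
  rewrite big_ord_recl ltr_pwDl ?step_gt0// sumr_ge0// => i _.
  exact/ltW/step_gt0.
rewrite mulrC ler_pdivlMr// mulr_sumr; apply: ler_sum => t _.
by rewrite mxE mulrC ler_wpM2l ?h// ltW// step_gt0.
Qed.

Lemma diminishing_le (A : sgd_scheme R) t :
  diminishing A -> step A t <= step A 0.
Proof. by move=> dA; elim: t => // t; apply: le_trans. Qed.

End scheme_output.

(** * The hard instance and the lower bound on the number of steps *)

Section instance.
Context {R : realType}.
Local Notation V := 'rV[R]_2.

Definition loss_coord (j : 'I_2) (s : R) : R := huber s.
(** The indicator writes a function of the first coordinate alone as a separable one, so that loss
    and risk share the same calculus. *)
Definition risk_coord (j : 'I_2) (s : R) : R := (j == 0)%:R * expR (- s).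

Definition bad_problem : problem R 2 :=
  Problem setT (separable loss_coord) (separable risk_coord)
    (fun l => dhuber l * expR l).

Definition exact_oracle : oracle R 2 unit :=
  Oracle \d_tt (fun x _ => grad (loss bad_problem) x)
    (fun _ x _ => grad (risk bad_problem) x).

Definition bad_start (l : R) : V := (2 * l + 4) *: delta_mx 0 1.
Definition optimum (l : R) : V := l *: delta_mx 0 0.

Local Notation Q := bad_problem.

Lemma is_derive_loss_coord j (s : R) : is_derive s 1 (loss_coord j) (dhuber s).
Proof. exact: is_derive_huber. Qed.

Lemma is_derive_risk_coord j (s : R) :
  is_derive s 1 (risk_coord j) (- risk_coord j s).
Proof. by rewrite -mulNr; exact: is_derive_expRN. Qed.

Lemma grad_loss x : grad (loss Q) x = \row_j dhuber (x 0 j).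
Proof.
exact: (grad_separable loss_coord (fun _ => dhuber) x is_derive_loss_coord).
Qed.

Lemma grad_risk x : grad (risk Q) x = \row_j - risk_coord j (x 0 j).
Proof.
exact: (grad_separable risk_coord (fun j s => - risk_coord j s) x
  is_derive_risk_coord).
Qed.

Lemma lossE x : loss Q x = huber (x 0 0) + huber (x 0 1).
Proof.
rewrite /= /separable big_ord_recl big_ord1 /loss_coord.
by have -> : lift ord0 ord0 = 1 :> 'I_2 by exact: val_inj.
Qed.

Lemma riskE x : risk Q x = expR (- x 0 0).
Proof.
rewrite /= /separable big_ord_recl big_ord1/= /risk_coord /=.
by rewrite mul0r addr0 mul1r.
Qed.

Lemma objective_optimum l : objective Q l (optimum l) = huber l + dhuber l.
Proof.
rewrite /objective lossE riskE /= !mxE /= mulr1 mulr0 huber0 addr0.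
by rewrite -mulrA -expRD subrr expR0 mulr1.
Qed.

(** Add the tangent bounds of [huber] at [l] and of the weighted exponential at [l]: their slopes
    [dhuber l] and [- dhuber l] cancel, which is what the weight is chosen for. *)
Lemma optimum_minimizer l :
  0 < l -> minimizer (feasible Q) (objective Q l) (optimum l).
Proof.
move=> l0; split => // x _; rewrite objective_optimum /objective lossE riskE/=.
have h1 := huber_tangent l (x 0 0).
have h2 := huber_ge0 (x 0 1).
have h3 : dhuber l * (1 - (x 0 0 - l)) <= dhuber l * expR l * expR (- x 0 0).
  rewrite -mulrA ler_wpM2l ?(ltW (dhuber_gt0 _ l0))// -expRD.
  by apply: le_trans (expR_ge1Dx _); lra.
apply: le_trans (lerD (lerD h1 h2) h3).
by rewrite le_eqVlt; apply/orP; left; apply/eqP; ring.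
Qed.

Lemma sgd_lower_bound (A : sgd_scheme R) (P : probability unit R)
    (xi : nat -> nat -> {RV P >-> unit}) l (T : nat) w : 0 < l ->
  diminishing A ->
  objective Q l (sgd_output Q exact_oracle xi A l (bad_start l) T w)
    <= 2 * objective Q l (optimum l) ->
  weight Q l <= (2 * l + 4) * T%:R.
Proof.
move=> l0 dA; rewrite objective_optimum.
set x := sgd_output _ _ _ _ _ _ _ _ => hx.
set g := weight Q l; have g0 : 0 < g by rewrite mulr_gt0 ?expR_gt0 ?dhuber_gt0.
have hl : huber l + dhuber l <= l + 1.
  apply: lerD; first by rewrite (le_trans (huber_le l))// gtr0_norm.
  by rewrite (le_trans (ler_norm _))// norm_dhuber_le1.
have {hx hl} : huber (x 0 0) + huber (x 0 1) <= 2 * (l + 1).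
  rewrite -lossE; apply: (@le_trans _ _ (objective Q l x)).
    by rewrite /objective lerDl mulr_ge0 ?(ltW g0)// riskE expR_ge0.
  by lra.
have le_huberD1 (s : R) : s <= huber s + 1.
  by have := huber_ge s; have := ler_norm s; lra.
have hx0 := le_huberD1 (x 0 0); have hx1 := le_huberD1 (x 0 1).
have px0 := huber_ge0 (x 0 0); have px1 := huber_ge0 (x 0 1) => hx.
have {hx hx0 hx1 px0 px1} [x00 x01] : x 0 0 <= 2 * l + 3 /\ x 0 1 <= 2 * l + 3.
  by split; lra.
(* The start itself fails: its second coordinate [2 * l + 4] exceeds [2 * l + 3]. *)
have T0 : (0 < T)%N.
  case: (posnP T) => // T0; move: x01.
  by rewrite /x T0 /= !mxE /= mulr1; lra.
set e := step A 0; have e0 : 0 < e by exact: step_gt0.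
pose y := iterate Q exact_oracle xi A l (bad_start l).
have yS t w' : y t.+1 w' = y t w' -
    step A t *: (grad (loss Q) (y t w') + g *: grad (risk Q) (y t w')).
  exact: (iterate_exact Q exact_oracle).
have y1S t : y t.+1 w 0 1 = y t w 0 1 - step A t * dhuber (y t w 0 1).
  by rewrite yS grad_loss grad_risk !mxE /risk_coord /= mul0r oppr0 mulr0 addr0.
have y0S t : y t.+1 w 0 0 =
    y t w 0 0 - step A t * (dhuber (y t w 0 0) - g * expR (- y t w 0 0)).
  by rewrite yS grad_loss grad_risk !mxE /risk_coord /= mul1r mulrN.
(* Here the steps are required to diminish: no later step is longer than the first. *)
have drift t s : step A t * dhuber s <= e.
  rewrite -[leRHS]mulr1 (le_trans (ler_norm _))// normrM ler_pM//.
    by rewrite gtr0_norm ?step_gt0// diminishing_le.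
  exact: norm_dhuber_le1.
have y1 t : 2 * l + 4 - t%:R * e <= y t w 0 1.
  elim: t => [|t IH]; first by rewrite /y /= !mxE /= mulr1 mul0r subr0.
  by rewrite y1S -natr1; have := drift t (y t w 0 1); lra.
(* The index is shifted because the first step, taken where the slope of [huber] is 0 and the risk
   is 1, gains exactly [e * g]. Afterwards the risk only pushes upwards. *)
have y0 t : e * (g - t%:R) <= y t.+1 w 0 0.
  elim: t => [|t IH].
    rewrite y0S /y /= !mxE /= mulr0 oppr0 expR0 dhuber0 -/e.
    by rewrite le_eqVlt; apply/orP; left; apply/eqP; ring.
  rewrite y0S -natr1; have := drift t.+1 (y t.+1 w 0 0).
  have : 0 <= step A t.+1 * (g * expR (- y t.+1 w 0 0)).
    by rewrite mulr_ge0 ?(ltW (step_gt0 _ _))// mulr_ge0 ?expR_ge0 ?(ltW g0).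
  by lra.
have b0 : e * (g - T%:R) <= x 0 0.
  apply: sgd_output_coord_ge => // t tT; apply: le_trans (y0 t).
  by rewrite ler_wpM2l ?(ltW e0)// lerD2l lerN2 ler_nat ltnW.
have b1 : 2 * l + 4 - T%:R * e <= x 0 1.
  apply: sgd_output_coord_ge => // t tT; apply: le_trans (y1 t.+1).
  by rewrite lerD2l lerN2 ler_wpM2r ?(ltW e0)// ler_nat.
have eT : 1 <= T%:R * e by lra.
(* From [b0] and [x00], [e * g <= 2 * l + 3 + e * T]; multiplying the constant term by [T * e >= 1]
   makes the bound homogeneous in [e], which then cancels. *)
have : e * g <= e * ((2 * l + 4) * T%:R).
  have : (2 * l + 3) * 1 <= (2 * l + 3) * (T%:R * e) by rewrite ler_wpM2l//; lra.
  by lra.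
by rewrite ler_pM2l.
Qed.

End instance.

(** * Verification of the assumptions on the instance *)

Section instance_assumptions.
Context {R : realType}.
Local Notation V := 'rV[R]_2.
Local Notation Q := (@bad_problem R).

Lemma weight_gt0 (l : R) : 0 < l -> 0 < weight Q l.
Proof. by move=> l0; rewrite mulr_gt0 ?expR_gt0 ?dhuber_gt0. Qed.

Lemma weight_ge (l : R) : 1 <= l -> expR l / 2 <= weight Q l.
Proof. by move=> l1; rewrite mulrC ler_wpM2r ?expR_ge0 ?dhuber_ge_half. Qed.

Lemma weight_le (l : R) : weight Q l <= expR l.
Proof.
by rewrite ler_piMl ?expR_ge0// (le_trans (ler_norm _)) ?norm_dhuber_le1.
Qed.

(** A factor 2 costs an arbitrarily small amount [e] of rate, since
    [expR (e * l) >= 1 + e * l >= 2]. *)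
Lemma half_expR (c e l : R) : 0 < e -> 0 < l -> 2 / e <= l ->
  expR ((c - e) * l) <= expR (c * l) / 2.
Proof.
move=> e0 l0 el; have -> : c * l = (c - e) * l + e * l by ring.
rewrite expRD -mulrA ler_peMr ?expR_ge0// ler_pdivlMr// mul1r.
have : 2 <= e * l by rewrite -ler_pdivrMl// mulrC.
by have := expR_ge1Dx (e * l); lra.
Qed.

(** The weight lies between [expR l / 2] and [expR l] for [l >= 1]. *)
Lemma limsup_rate_weight : limsup_rate (fun l => (weight Q l)%:E) = 1%:E.
Proof.
apply/eqP; rewrite eq_le; apply/andP; split.
  apply: limsup_rate_le => e e0; exists 0 => l l0.
  rewrite -(@log_rate_expR _ (1 + e) l) ?gt_eqF//.
  apply: le_log_rate => //; rewrite lee_fin; first exact/ltW/weight_gt0.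
  rewrite (le_trans (weight_le l))// ler_expR ler_peMl ?(ltW l0)//.
  by rewrite lerDl ltW.
apply/lee_subgt0Pr => e e0.
rewrite -EFinB; apply: (@limsup_rate_ge _ _ _ (Num.max 1 (2 / e))) => l.
rewrite gt_max => /andP[l1 le2]; have l0 : 0 < l by apply: lt_trans l1.
rewrite -(@log_rate_expR _ (1 - e) l) ?gt_eqF//.
apply: le_log_rate => //; rewrite lee_fin ?expR_ge0//.
apply: le_trans (weight_ge l (ltW l1)); rewrite -[in leRHS](mul1r l).
by apply: half_expR => //; exact: ltW.
Qed.

Lemma bad_LDP : target_risk_LDP Q optimum 1.
Proof.
split=> //; last exact: limsup_rate_weight.
apply: cvg_near_cst; near=> l.
have l0 : 0 < l by near: l; exact: nbhs_pinfty_gt.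
rewrite -(@log_rate_expR _ (-1) l) ?gt_eqF// /log_rate riskE !mxE /=.
by rewrite mulr1 mulN1r.
Unshelve. all: by end_near. Qed.

Lemma bad_efficient : efficient_estimators Q exact_oracle.
Proof.
have cont_loss (j : 'I_2) : continuous (fun x : V => dhuber (x 0 j)).
  move=> x; apply: differentiable_continuous.
  by apply: differentiable_compose_coord; case: (is_derive_dhuber (x 0 j)).
have cont_risk (j : 'I_2) : continuous (fun x : V => - risk_coord j (x 0 j)).
  move=> x; apply: differentiable_continuous.
  apply: (@differentiable_compose_coord _ _ (fun s => - risk_coord j s)).
  by apply: derivableN; case: (is_derive_risk_coord j (x 0 j)).
(* Exact gradients have no error, and the rate of the zero function is [-oo] because
   [lne 0 = -oo]. *)
exists 0, (fun=> 0); split => //.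
- apply: limsup_rate_le => e e0; exists 0 => l l0.
  by rewrite /log_rate /= lexx gt0_muleNy ?lte_fin ?invr_gt0// leNye.
- split.
    apply: exact_estimator => // j.
    by under eq_fun do rewrite grad_loss mxE; exact: cont_loss.
  by move=> x _; rewrite exact_estimator_error lee_fin sqr_ge0.
- move=> l l0; split.
    apply: exact_estimator => // j.
    by under eq_fun do rewrite grad_risk mxE; exact: cont_risk.
  by move=> x _; rewrite exact_estimator_error lee_fin mulr_ge0// sqr_ge0.
Qed.

Lemma bad_smooth_convex_loss : smooth_convex_loss Q.
Proof.
split.
- by move=> x y t _ _; rewrite inE.
- exact: closedT.
- by exists 0.
- apply: (@C2_on_separable _ _ loss_coord (fun _ => dhuber) (fun _ => ddhuber)).
  + exact: is_derive_loss_coord.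
  + by move=> j s; exact: is_derive_dhuber.
  + by move=> j; exact: continuous_ddhuber.
- split.
    apply: (@convex_separable _ _ _ (fun _ => dhuber)) => j s t.
    exact: huber_tangent.
  exists 1 => // x _.
  rewrite (hess_separable loss_coord (fun _ => dhuber) (fun _ => ddhuber) x
    is_derive_loss_coord (fun=> is_derive_dhuber)).
  apply: spectral_norm_diag => // j.
  by rewrite mxE ger0_norm ?ddhuber_ge0 ?ddhuber_le1.
Qed.

Lemma coord_le_loss (x : V) j : `|x 0 j| <= loss Q x + 1.
Proof.
have := huber_ge (x 0 j); suff : huber (x 0 j) <= loss Q x by lra.
rewrite /= /separable (bigD1 j)//= lerDl sumr_ge0// => i _; exact: huber_ge0.
Qed.

Lemma loss_ge0 (x : V) : 0 <= loss Q x.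
Proof. by apply: sumr_ge0 => j _; exact: huber_ge0. Qed.

Lemma loss_0 : loss Q 0 = 0.
Proof. by rewrite lossE !mxE huber0 addr0. Qed.

Lemma bad_sublevel_bounded : sublevel_bounded Q.
Proof.
(* Where the loss is at most 1, coordinates are at most 2 in modulus; two such points are at squared
   distance at most [2 * 4 ^+ 2 = 32], below [8 ^+ 2]. *)
exists 1, 8; split => //.
  by exists 0; split => //=; rewrite -[X in X <= _]/(loss Q 0) loss_0.
apply: ge_ereal_sup => _ [x [_ /= x1] [y [_ /= y1] <-]]; rewrite lee_fin /enorm.
rewrite -(@ger0_norm _ 8)// -sqrtr_sqr; apply: ler_wsqrtr.
apply: (@le_trans _ _ (\sum_(j < 2) 4 ^+ 2)).
  apply: ler_sum => j _; rewrite !mxE -real_normK ?num_real//.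
  rewrite lerXn2r ?nnegrE//; apply: (le_trans (ler_normB _ _)).
  have := coord_le_loss x j; have := coord_le_loss y j.
  by rewrite /= => *; lra.
by rewrite sumr_const card_ord; lra.
Qed.

Lemma risk_coord_ge0 j (s : R) : 0 <= risk_coord j s.
Proof. by rewrite mulr_ge0 ?expR_ge0. Qed.

Lemma bad_relative_bounds : relative_bounds Q 0.
Proof.
have dd j (s : R) : is_derive s 1 (fun s => - risk_coord j s) (risk_coord j s).
  rewrite -[risk_coord j s]opprK; apply: is_deriveN; exact: is_derive_risk_coord.
have rle (x : V) j : risk_coord j (x 0 j) <= risk Q x.
  rewrite /= /separable (bigD1 j)//= lerDl sumr_ge0// => i _.
  exact: risk_coord_ge0.
have p0 (x : V) : 0 <= risk Q x by rewrite riskE expR_ge0.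
split => //.
  apply: (@C2_on_separable _ _ risk_coord (fun j s => - risk_coord j s)
    risk_coord) => //.
    exact: is_derive_risk_coord.
  by move=> j; exact: continuous_expRN.
(* Gradient and Hessian of the exponential are bounded by the risk itself; with exponents 0 the
   distance factor is the constant 2. *)
exists 1, 1, 0, 0; split => // x _; rewrite powRr0 mul1r.
have le2 : risk Q x <= (1 + 1) * risk Q x by have := p0 x; lra.
split; apply: le_trans le2.
  rewrite riskE /enorm grad_risk big_ord_recl big_ord1 !mxE.
  rewrite /risk_coord/= mul0r oppr0 expr0n addr0 sqrtr_sqr mul1r normrN.
  by rewrite gtr0_norm ?expR_gt0.
rewrite (hess_separable risk_coord (fun j s => - risk_coord j s) risk_coord x
  is_derive_risk_coord dd).
apply: spectral_norm_diag => // j.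
by rewrite mxE ger0_norm ?risk_coord_ge0.
Qed.

Lemma bad_convex_objective : convex_objective Q.
Proof.
move=> l l0.
have -> : objective Q l =
    separable (fun j s => loss_coord j s + weight Q l * risk_coord j s).
  by apply/funext => x; rewrite /objective {}/separable big_split mulr_sumr.
apply: (@convex_separable _ _ _
  (fun j s => dhuber s - weight Q l * risk_coord j s)) => j s t.
have h : weight Q l * (risk_coord j s - risk_coord j s * (t - s)) <=
    weight Q l * risk_coord j t.
  rewrite ler_wpM2l ?(ltW (weight_gt0 l l0))// /risk_coord -mulrA -mulrBr.
  by rewrite ler_wpM2l// expRN_tangent.
have := lerD (huber_tangent s t) h; apply: le_trans.
by rewrite /loss_coord le_eqVlt; apply/orP; left; apply/eqP; ring.
Qed.

(** The first coordinate of the start is 0, so the risk there is 1 and its rate is 0 instead of at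
    most -1. *)
Lemma bad_start_unsafe : ~ safe_start Q bad_start 1.
Proof.
rewrite /safe_start => h.
have : (0%:E <= limsup_rate (fun l => (risk Q (bad_start l))%:E))%E.
  apply: (@limsup_rate_ge _ _ _ 0) => l l0.
  by rewrite log_rate_fin riskE !mxE /= mulr0 oppr0 expR0 ?ln1 ?mulr0.
by move=> /le_trans /(_ h); rewrite lee_fin; lra.
Qed.

Lemma enorm_bad_start (l : R) : 0 < l -> enorm (bad_start l - 0) = 2 * l + 4.
Proof.
move=> l0; rewrite subr0 /enorm big_ord_recl big_ord1 !mxE /= mulr0 expr0n add0r.
by rewrite mulr1 sqrtr_sqr ger0_norm//; lra.
Qed.

(** Squaring [expR (e * l / 2) >= 1 + e * l / 2] yields the quadratic term [e ^+ 2 * l ^+ 2 / 4],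
    which is at least [6 * l] as soon as [e ^+ 2 * l >= 24]. *)
Lemma linear_le_expR (e l : R) : 0 < e -> 24 / e ^+ 2 <= l ->
  6 * l <= expR (e * l).
Proof.
move=> e0 el.
have l0 : 0 < l by rewrite (lt_le_trans _ el)// divr_gt0// exprn_gt0.
have {}el : 24 <= l * e ^+ 2 by rewrite -ler_pdivrMr ?exprn_gt0.
have -> : e * l = e * l / 2 + e * l / 2 by field.
rewrite expRD -expr2; apply: (@le_trans _ _ ((1 + e * l / 2) ^+ 2)).
  have h : 24 * l <= l * e ^+ 2 * l by rewrite ler_wpM2r// ltW.
  have -> : (1 + e * l / 2) ^+ 2 = 1 + e * l + l * e ^+ 2 * l / 4 by field.
  by have := mulr_gt0 e0 l0; lra.
rewrite lerXn2r ?nnegrE ?expR_ge0 ?expR_ge1Dx//.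
by have := mulr_gt0 e0 l0; lra.
Qed.

Lemma bad_start_distance : subexponential_distance 0 (@bad_start R).
Proof.
apply: limsup_rate_le => e e0; rewrite add0r.
exists (Num.max 1 (24 / e ^+ 2)) => l; rewrite gt_max => /andP[l1 le2].
have l0 : 0 < l by apply: lt_trans l1.
rewrite -(@log_rate_expR _ e l) ?gt_eqF//.
apply: le_log_rate => //; rewrite lee_fin enorm_bad_start//; first by lra.
apply: (@le_trans _ _ (6 * l)); first by lra.
by apply: linear_le_expR => //; exact: ltW.
Qed.

Lemma sampling_complexity_ge (A : sgd_scheme R)
    (xi : nat -> nat -> {RV (\d_tt : probability unit R) >-> unit}) l :
  0 < l -> diminishing A ->
  ((weight Q l / (2 * l + 4))%:E <=
    sampling_complexity Q exact_oracle xi 1 2^-1 A l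
      (optimum l) (bad_start l))%E.
Proof.
move=> l0 dA; apply: le_ereal_inf_tmp => _ [T /= hT <-]; rewrite lee_fin.
have {hT} good :
    objective Q l (sgd_output Q exact_oracle xi A l (bad_start l) T tt)
    <= 2 * objective Q l (optimum l).
  (* Events of the one-point space have probability 0 or 1, so confidence one half forces the event
     to hold at [tt]. *)
  move: hT; rewrite diracE; case: (boolP (tt \in _)) => [|_].
    by rewrite inE.
  by rewrite lee_fin mulr0n; lra.
rewrite ler_pdivrMr; last by lra.
rewrite [leRHS]mulrC.
apply: le_trans (sgd_lower_bound A _ xi l T tt l0 dA good) _.
rewrite ler_wpM2l//; first by lra.
by rewrite ler_nat leq_pmulr// batch_gt0.
Qed.

End instance_assumptions.

Theorem theorem2 (R : realType) :
  exists (eps kappa : R) (n : nat) (Q : problem R n.+1)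
         (xstar x0 : R -> 'rV[R]_n.+1) (xmin : 'rV[R]_n.+1) (I : R)
         (d dO : measure_display)
         (Xi : measurableType d) (Omega : measurableType dO)
         (O : oracle R n.+1 Xi)
         (P : probability Omega R) (xi : nat -> nat -> {RV P >-> Xi}),
    (0 < eps /\ 0 < 1 - kappa < 1) /\
    (forall l : R, 0 < l ->
       [/\ 0 < weight Q l,
           minimizer (feasible Q) (objective Q l) (xstar l) &
           feasible Q (x0 l)]) /\
    minimizer (feasible Q) (loss Q) xmin /\
    iid_array (noise_law O) xi /\
    target_risk_LDP Q xstar I /\
    efficient_estimators Q O /\
    smooth_convex_loss Q /\
    sublevel_bounded Q /\
    loss Q xmin = 0 /\
    relative_bounds Q xmin /\
    convex_objective Q /\
    ~ safe_start Q x0 I /\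
    subexponential_distance xmin x0 /\
    forall A : R -> sgd_scheme R,
      (forall l : R, 0 < l -> diminishing (A l)) ->
      (0 < limsup_rate (fun l : R =>
             sampling_complexity Q O xi eps kappa (A l) l (xstar l) (x0 l)))%E.
Proof.
(* The tolerance 1 allows twice the optimal value; [1%N] is the predecessor of the dimension 2. *)
exists 1, 2^-1, 1%N, bad_problem, optimum, bad_start, 0, 1, _, _, unit, unit,
  exact_oracle, \d_tt, (fun _ _ => cst tt).
split; first by split; lra.
split.
  by move=> l l0; split; [exact: weight_gt0|exact: optimum_minimizer|].
split; first by split => // x _; rewrite loss_0 loss_ge0.
split; first exact: iid_array_unit.
split; first exact: bad_LDP.
split; first exact: bad_efficient.
split; first exact: bad_smooth_convex_loss.
split; first exact: bad_sublevel_bounded.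
split; first exact: loss_0.
split; first exact: bad_relative_bounds.
split; first exact: bad_convex_objective.
split; first exact: bad_start_unsafe.
split; first exact: bad_start_distance.
(* Claiming only the rate 1/2 leaves a factor [expR (l / 2)] to absorb the denominator [2 * l + 4]
   and the constant 2. *)
move=> A dA; apply: (@lt_le_trans _ _ (2^-1)%:E); first by rewrite lte_fin; lra.
(* The threshold is [24 / e ^+ 2] at [e = 1/4], the exponent used below in [linear_le_expR]. *)
apply: (@limsup_rate_ge _ _ _ 384) => l l384.
have l0 : 0 < l by lra.
rewrite -(@log_rate_expR _ 2^-1 l) ?gt_eqF//.
apply: le_log_rate => //.
apply: le_trans (sampling_complexity_ge _ _ _ l0 (dA l l0)).
rewrite lee_fin ler_pdivlMr; last by lra.
apply: le_trans (weight_ge l _); last by lra.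
have h : 6 * l <= expR (4^-1 * l) by apply: linear_le_expR; lra.
have -> : expR l = expR (2^-1 * l) * (expR (4^-1 * l) * expR (4^-1 * l)).
  by rewrite -!expRD; congr expR; lra.
rewrite -mulrA ler_wpM2l ?expR_ge0// ler_pdivlMr//.
apply: (@le_trans _ _ (6 * l * (6 * l))); last by rewrite ler_pM//; lra.
have : 384 * l <= l * l by rewrite ler_wpM2r// ltW.
by lra.
Qed.
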